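(* Let $\mathbb{F}=\mathbb{R}$ or $\mathbb{F}=\mathbb{C}$, let $m\geq n\geq 1$ be integers, and let $X,Y\in M_{m\times n}(\mathbb{F})$ with $X\neq 0$. There is a positive definite $A\in M_{m}(\mathbb{F})$ such that $AX=Y$ if and only if $X^*Y\geq 0$, $\operatorname{null} Y=\operatorname{null}(X^*Y)$, and $\operatorname{rank} Y=\operatorname{rank} X$.
   Context: $M_{m\times n}(\mathbb{F})$ is the set of $m\times n$ matrices over $\mathbb{F}$ and $M_m(\mathbb{F})=M_{m\times m}(\mathbb{F})$. $\operatorname{null} Z$ denotes the null space of $Z$, and $Z^*$ its conjugate transpose (the transpose if $\mathbb{F}=\mathbb{R}$). A matrix $A\in M_k(\mathbb{F})$ is positive semidefinite, written $A\geq 0$ (respectively, positive definite, written $A>0$), if $A$ is Hermitian ($A=A^*$) and $\mathbf{u}^*A\mathbf{u}\geq 0$ (respectively, $\mathbf{u}^*A\mathbf{u}>0$) for all nonzero $\mathbf{u}\in\mathbb{F}^k$. *)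

(* Defs.v *)
From HB Require Import structures.
From mathcomp Require Import all_boot all_order all_algebra.

Set Implicit Arguments.
Unset Strict Implicit.
Unset Printing Implicit Defensive.

Import GRing.Theory Num.Theory.
Local Open Scope ring_scope.
Local Open Scope sesquilinear_scope.

(* The real and the complex case are treated at once: [theta] is the
   conjugation of the scalar field, [idfun] over the reals and [Num.conj] over
   the complex numbers, so that [Z ^t theta] is the (conjugate) transpose.
   The order of a [numFieldType] is partial: over the complex numbers
   [0 <= z] means that z is real and nonnegative. *)
Section Semidefinite.
Variables (F : numFieldType) (theta : F -> F) (k : nat).

Definition quadform (A : 'M[F]_k) (u : 'cV[F]_k) : F :=
  (u ^t theta *m A *m u) 0 0.

Definition posdefmx (A : 'M[F]_k) : Prop :=
  A \is hermitianmx k false theta /\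
  forall u : 'cV[F]_k, u != 0 -> 0 < quadform A u.

Definition possemidefmx (A : 'M[F]_k) : Prop :=
  A \is hermitianmx k false theta /\
  forall u : 'cV[F]_k, u != 0 -> 0 <= quadform A u.

End Semidefinite.

(* The kernel on column vectors; the library's [kermx] is the kernel on row
   vectors. *)
Definition nullspace (F : fieldType) (p q : nat) (Z : 'M[F]_(p, q)) :
  {pred 'cV[F]_q} := [pred u | Z *m u == 0].

(* Main.v *)
Require Import Defs.
From HB Require Import structures.
From mathcomp Require Import all_boot all_order all_algebra.
From mathcomp Require Import reals complex ring.

Set Implicit Arguments.
Unset Strict Implicit.
Unset Printing Implicit Defensive.

Import Order.TTheory GRing.Theory Num.Theory.
Local Open Scope ring_scope.
Local Open Scope sesquilinear_scope.
Local Open Scope complex_scope.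

(** If [A > 0] and [A X = Y] then [X^* Y = X^* A X], and everything follows from
    the injectivity of [A].  Conversely, [X^* Y >= 0] and the null space
    condition give [null X <= null Y], hence equality by the rank condition.
    Write [X = B C] with [B] of full column rank and [C] with a right inverse
    [W], and put [D = Y W], so that [B = X W] and [Y = D C].  Then
    [H = B^* D = W^* (X^* Y) W] is positive definite, and
    [A = D H^-1 D^* + K^* K] maps [B] to [D] as soon as the kernel of [K] is the
    column space of [X]; moreover [u^* A u = 0] forces [u = B w] and
    [0 = D^* u = H w], hence [u = 0]. *)

Section ConjugateTranspose.
Variables (F : numFieldType) (theta : {rmorphism F -> F}).
(** Besides being a ring morphism, conjugation enters only through these two identities, which
    [idfun] over the reals and [Num.conj] over the complex numbers both satisfy. *)
Hypothesis thetaK : involutive theta.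
Hypothesis theta_norm : forall x : F, `|x| ^+ 2 = x * theta x.

Lemma ctrmx_mul p q r (A : 'M[F]_(p, q)) (B : 'M[F]_(q, r)) :
  (A *m B) ^t theta = B ^t theta *m A ^t theta.
Proof. by rewrite trmx_mul map_mxM. Qed.

Lemma ctrmxK p q (A : 'M[F]_(p, q)) : (A ^t theta) ^t theta = A.
Proof. by apply/matrixP => i j; rewrite !mxE thetaK. Qed.

Lemma ger0_theta x : 0 <= x -> theta x = x.
Proof.
rewrite le0r => /orP[/eqP-> | x_gt0]; first exact: rmorph0.
apply: (mulfI (lt0r_neq0 x_gt0)).
by rewrite -theta_norm gtr0_norm // expr2.
Qed.

Lemma ctrmx_norm_ge0 k (u : 'cV[F]_k) : 0 <= (u ^t theta *m u) 0 0.
Proof.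
rewrite mxE; apply: sumr_ge0 => i _.
by rewrite !mxE mulrC -theta_norm exprn_ge0.
Qed.

Lemma ctrmx_norm_eq0 k (u : 'cV[F]_k) : (u ^t theta *m u) 0 0 = 0 -> u = 0.
Proof.
have u_ge0 i : 0 <= (u ^t theta) 0 i * u i 0.
  by rewrite !mxE mulrC -theta_norm exprn_ge0.
rewrite mxE => /eqP; rewrite psumr_eq0 // => /allP u0.
apply/matrixP => i j; rewrite ord1 mxE; apply/eqP.
have /eqP := u0 i (mem_index_enum i); rewrite !mxE mulrC -theta_norm.
by move/eqP; rewrite expf_eq0 normr_eq0.
Qed.

Lemma hermitianP k (A : 'M[F]_k) :
  reflect (A ^t theta = A) (A \is hermitianmx k false theta).
Proof.
by rewrite is_hermitianmxE expr0 scale1r eq_sym; apply: eqP.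
Qed.

Lemma quadform0 k (A : 'M[F]_k) : quadform theta A 0 = 0.
Proof. by rewrite /quadform mulmx0 mxE. Qed.

Lemma quadform_congr p q (A : 'M[F]_p) (W : 'M[F]_(p, q)) u :
  quadform theta (W ^t theta *m A *m W) u = quadform theta A (W *m u).
Proof. by rewrite /quadform ctrmx_mul !mulmxA. Qed.

Lemma possemidef_ge0 k (A : 'M[F]_k) u :
  possemidefmx theta A -> 0 <= quadform theta A u.
Proof.
by case=> _ A_ge0; have [->|/A_ge0//] := eqVneq u 0; rewrite quadform0.
Qed.

(* Otherwise the form would be negative at [v - t A v] for small [t > 0]. *)
Lemma possemidef_isotropic k (A : 'M[F]_k) v :
  possemidefmx theta A -> quadform theta A v = 0 -> A *m v = 0.
Proof.
move=> psdA qv0; have [/hermitianP hA _] := psdA.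
set w := A *m v; set a : F := (w ^t theta *m w) 0 0; set b := quadform theta A w.
have a_ge0 : 0 <= a := ctrmx_norm_ge0 w.
have b_ge0 : 0 <= b := possemidef_ge0 w psdA.
have b1_gt0 : 0 < b + 1 by rewrite ltr_wpDl.
(* The form at [v - t *: w] is [t * (t * b - a *+ 2)], smallest at [t = a / b]. Replacing [b] by
   [b + 1] avoids a zero denominator and still makes the second factor [- (a + t)]. *)
pose t := a / (b + 1).
have t_ge0 : 0 <= t by rewrite divr_ge0 // ltW.
have vAw : v ^t theta *m A *m w = w ^t theta *m w.
  by rewrite ctrmx_mul hA.
have wAv : w ^t theta *m A *m v = w ^t theta *m w by rewrite -mulmxA.
have : 0 <= quadform theta A (v - t *: w) := possemidef_ge0 _ psdA.
have -> : quadform theta A (v - t *: w) = t * (t * b - a *+ 2).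
  have adj_vtw : (v - t *: w) ^t theta = v ^t theta - t *: w ^t theta.
    by apply/matrixP => i j; rewrite !mxE rmorphB rmorphM /= (ger0_theta t_ge0).
  rewrite /quadform adj_vtw !mulmxBl !mulmxBr -!(scalemxAl, scalemxAr) vAw wAv.
  have -> : v ^t theta *m A *m v = 0.
    by apply/matrixP => i j; rewrite !ord1 [RHS]mxE; apply: qv0.
  set P := w ^t theta *m w; set Q := w ^t theta *m A *m w.
  by rewrite -[a]/(P 0 0) -[b]/(Q 0 0) !mxE; ring.
have tb1 : t * (b + 1) = a by rewrite divfK // lt0r_neq0.
have [t0 _|t_neq0] := eqVneq t 0.
  by apply: ctrmx_norm_eq0; rewrite -/a -tb1 t0 mul0r.
have t_gt0 : 0 < t by rewrite lt0r t_neq0.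
have -> : t * b - a *+ 2 = - (a + t) by rewrite -tb1; ring.
by rewrite pmulr_rge0 // oppr_ge0 => /le_gtF; rewrite ltr_wpDl.
Qed.

Lemma unitmx_inj k (A : 'M[F]_k) :
  (forall u : 'cV[F]_k, A *m u = 0 -> u = 0) -> A \in unitmx.
Proof.
move=> injA; rewrite -unitmx_tr -row_free_unit; apply: inj_row_free => v vA0.
apply: trmx_inj; rewrite trmx0; apply: injA.
by rewrite -[A]trmxK -trmx_mul vA0 trmx0.
Qed.

Lemma posdef_unitmx k (A : 'M[F]_k) : posdefmx theta A -> A \in unitmx.
Proof.
case=> _ A_gt0; apply: unitmx_inj => u Au0; apply/eqP/negPn/negP => /A_gt0.
by rewrite /quadform -mulmxA Au0 mulmx0 mxE ltxx.
Qed.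

Lemma posdef_possemidef k (A : 'M[F]_k) :
  posdefmx theta A -> possemidefmx theta A.
Proof. by case=> hA A_gt0; split=> // u /A_gt0/ltW. Qed.

(** The columns of [cokermx Z] lie in the null space of [Z], so [T] kills them all. Null space
    inclusions thus become reversed inclusions of row spaces. *)
Lemma nullspace_submx p q r (Z : 'M[F]_(p, r)) (T : 'M[F]_(q, r)) :
  {subset nullspace Z <= nullspace T} -> (T <= Z)%MS.
Proof.
move=> nullZT; rewrite submxE; apply/eqP/matrixP => i j.
have /nullZT : col j (cokermx Z) \in nullspace Z.
  by rewrite inE colE mulmxA mulmx_coker mul0mx.
by rewrite inE colE mulmxA -colE => /eqP/matrixP/(_ i 0); rewrite !mxE.
Qed.

Lemma posdef_interp_necessary m n (X Y : 'M[F]_(m, n)) (A : 'M[F]_m) :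
  posdefmx theta A -> A *m X = Y ->
  [/\ possemidefmx theta (X ^t theta *m Y),
      nullspace Y =i nullspace (X ^t theta *m Y)
    & \rank Y = \rank X].
Proof.
move=> pdA <-; have [/hermitianP hA A_gt0] := pdA.
have psdA := posdef_possemidef pdA; rewrite mulmxA; split.
- split=> [|u _]; last by rewrite quadform_congr possemidef_ge0.
  by apply/hermitianP; rewrite !ctrmx_mul ctrmxK hA mulmxA.
- move=> u; rewrite !inE -!mulmxA; apply/eqP/eqP => [->|XAXu0].
    by rewrite mulmx0.
  (* Multiplying [XAXu0] on the left by the adjoint of [u] shows that the form of [A] vanishes at
     [X *m u]. *)
  apply: (possemidef_isotropic psdA).
  by rewrite -quadform_congr /quadform -!mulmxA XAXu0 mulmx0 mxE.
by rewrite eqmxMfull // row_full_unit posdef_unitmx.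
Qed.

Lemma full_rank_factorization m n (X : 'M[F]_(m, n)) :
  exists r (B : 'M_(m, r)) (C : 'M_(r, n)) (B' : 'M_(r, m)) (W : 'M_(n, r)),
    [/\ X = B *m C, B' *m B = 1%:M & C *m W = 1%:M].
Proof.
have /row_fullP[B' B'B] := col_base_full X.
have /row_freeP[W CW1] := row_base_free X.
by exists (\rank X), (col_base X), (row_base X), B', W; rewrite mulmx_base.
Qed.

Lemma posdef_interp_sufficient m n (X Y : 'M[F]_(m, n)) :
  possemidefmx theta (X ^t theta *m Y) ->
  nullspace Y =i nullspace (X ^t theta *m Y) ->
  \rank Y = \rank X ->
  exists A : 'M[F]_m, posdefmx theta A /\ A *m X = Y.
Proof.
set G := X ^t theta *m Y => psdG nullY rankY.
have [/hermitianP hG _] := psdG.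
(* As [G] is Hermitian it also equals [Y ^t theta *m X], so [X *m u = 0] gives [G *m u = 0] and then
   [Y *m u = 0]. *)
have YX : (Y <= X)%MS.
  apply: nullspace_submx => u; rewrite nullY !inE => /eqP Xu0.
  by rewrite -hG /G ctrmx_mul ctrmxK -mulmxA Xu0 mulmx0.
have /submxP[S XSY] : (X <= Y)%MS.
  by rewrite -(geq_leqif (mxrank_leqif_sup YX)) rankY.
have /submxP[T YTX] := YX.
have [r [B [C [B' [W [XBC B'B CW1]]]]]] := full_rank_factorization X.
have BXW : B = X *m W by rewrite XBC -mulmxA CW1 mulmx1.
pose D := Y *m W.
have YDC : Y = D *m C.
  by rewrite /D [in RHS]YTX -(mulmxA T) -BXW -mulmxA -XBC.
pose H := B ^t theta *m D.
have HWGW : H = W ^t theta *m G *m W by rewrite /H BXW ctrmx_mul /G !mulmxA.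
have hH : H ^t theta = H by rewrite HWGW 2!ctrmx_mul hG ctrmxK mulmxA.
have DBH : D ^t theta *m B = H by rewrite -hH [in RHS]ctrmx_mul ctrmxK.
have H_ge0 w : 0 <= quadform theta H w.
  by rewrite HWGW quadform_congr possemidef_ge0.
(* An isotropic [w] is killed in turn by [G *m W], by [Y *m W] (null space condition), by
   [X *m W = B] (as [X = S *m Y]), and [B] has a left inverse. *)
have H_inj w : quadform theta H w = 0 -> w = 0.
  rewrite HWGW quadform_congr => /(possemidef_isotropic psdG) GWw0.
  have : W *m w \in nullspace Y by rewrite nullY inE GWw0.
  rewrite inE => /eqP YWw0.
  have : X *m (W *m w) = 0 by rewrite XSY -mulmxA YWw0 mulmx0.
  rewrite mulmxA -BXW => Bw0.
  by rewrite -[w]mul1mx -B'B -mulmxA Bw0 mulmx0.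
have uH : H \in unitmx.
  apply: unitmx_inj => w Hw0; apply: H_inj.
  by rewrite /quadform -mulmxA Hw0 mulmx0 mxE.
(* The transposes turn the row space statement for [cokermx] into one on columns: [K *m u = 0]
   exactly when [u] is in the column space of [X]. *)
pose K := (cokermx X^T)^T.
have KX0 : K *m X = 0.
  by apply: trmx_inj; rewrite trmx_mul trmxK mulmx_coker trmx0.
pose A := D *m invmx H *m D ^t theta + K ^t theta *m K.
(* Since [H] is Hermitian, [invmx H] is the congruence of [H] by [invmx H], which exhibits the form
   of [A] as a sum of two nonnegative terms. *)
have AE u : quadform theta A u =
    quadform theta H (invmx H *m (D ^t theta *m u))
    + ((K *m u) ^t theta *m (K *m u)) 0 0.
  rewrite /quadform /A mulmxDr mulmxDl [LHS]mxE; congr (_ + _); last first.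
    by rewrite ctrmx_mul !mulmxA.
  set w := D ^t theta *m u.
  rewrite (ctrmx_mul (invmx H)) trmx_inv map_invmx hH mulmxKV //.
  have -> : w ^t theta = u ^t theta *m D by rewrite (ctrmx_mul _ u) ctrmxK.
  by rewrite /w !mulmxA.
exists A; split; last first.
  rewrite /A mulmxDl -(mulmxA _ K) KX0 mulmx0 addr0.
  by rewrite [in LHS]XBC mulmxA -(mulmxA _ _ B) DBH mulmxKV // -YDC.
split=> [|u u_neq0].
  apply/hermitianP; rewrite /A linearD /= map_mxD !ctrmx_mul !ctrmxK.
  by rewrite trmx_inv map_invmx hH mulmxA.
have A_ge0 : 0 <= quadform theta A u.
  by rewrite AE addr_ge0 // ctrmx_norm_ge0.
rewrite lt0r A_ge0 andbT; apply: contraNneq u_neq0.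
move=> /eqP; rewrite AE paddr_eq0 ?ctrmx_norm_ge0 //.
case/andP=> /eqP/H_inj Du0 /eqP/ctrmx_norm_eq0 Ku0.
have /submxP[v uvX] : (u^T <= X^T)%MS.
  by rewrite submxE -[cokermx _]trmxK -trmx_mul Ku0 trmx0.
have uB : u = B *m (C *m v^T).
  by rewrite mulmxA -XBC; apply: trmx_inj; rewrite trmx_mul trmxK.
(* Since [D ^t theta *m B = H], the vector that [Du0] makes zero is the coordinate vector [C *m v^T]
   itself. *)
move: Du0; rewrite uB (mulmxA _ B) DBH mulKmx // => ->.
by rewrite mulmx0.
Qed.

End ConjugateTranspose.

Theorem corollary5p2 (R : realType) (m n : nat) (hn : (1 <= n)%N)
    (hmn : (n <= m)%N) :
  (forall X Y : 'M[R]_(m, n), X != 0 ->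
     (exists A : 'M[R]_m, posdefmx idfun A /\ A *m X = Y) <->
     [/\ possemidefmx idfun (X ^t idfun *m Y),
         nullspace Y =i nullspace (X ^t idfun *m Y)
       & \rank Y = \rank X]) /\
  (forall X Y : 'M[R[i]]_(m, n), X != 0 ->
     (exists A : 'M[R[i]]_m, posdefmx Num.conj A /\ A *m X = Y) <->
     [/\ possemidefmx Num.conj (X ^t Num.conj *m Y),
         nullspace Y =i nullspace (X ^t Num.conj *m Y)
       & \rank Y = \rank X]).
Proof.
split=> X Y _; split.
- case=> A [pdA AX]; apply: (posdef_interp_necessary _ _ pdA AX) => // x.
  by rewrite real_normK ?num_real.
- case=> psdG nullY rankY.
  apply: posdef_interp_sufficient psdG nullY rankY => // x.
  by rewrite real_normK ?num_real.
- case=> A [pdA AX]; apply: (posdef_interp_necessary _ _ pdA AX).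
    exact: conjCK.
  exact: normCK.
- case=> psdG nullY rankY.
  apply: posdef_interp_sufficient psdG nullY rankY.
    exact: conjCK.
  exact: normCK.
Qed.
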